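(* Let $D$ be an integral domain with integral closure $\overline{D}$ (in its quotient field) such that $(D:\overline{D})\neq (0)$. If $D$ is quasi-stable, then every overring of $D$ is quasi-stable.
   Context: Let $K$ be the quotient field of $D$. $(D:\overline{D})=\{x\in K\mid x\overline{D}\subseteq D\}$. ''Ideal'' of a domain means fractional ideal: for a domain $R$ with quotient field $K$, an $R$-submodule $I$ of $K$ with $dI\subseteq R$ for some nonzero $d\in R$. An overring of $D$ is a ring $T$ with $D\subseteq T\subseteq K$. For a nonzero ideal $I$ of a domain $R$ with quotient field $K$, $(I:I)=\{x\in K\mid xI\subseteq I\}$, a ring between $R$ and $K$; $I$ is quasi-stable if $I$ is flat as an $(I:I)$-module. A domain is quasi-stable if each of its nonzero ideals is quasi-stable. *)

(* Defs.v *)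
From HB Require Import structures.
From mathcomp Require Import all_boot all_order all_algebra.
From mathcomp Require Import boolp.
From mathcomp Require Import freeg.

Set Implicit Arguments.
Unset Strict Implicit.
Unset Printing Implicit Defensive.

Import GRing.Theory.

Local Open Scope ring_scope.
Local Open Scope quotient_scope.

Section TensorProduct.
Variables (R : comNzRingType) (M N : lmodType R).

Local Notation free := {freeg (M * N)%type / int}.
Local Notation gen x y := (<< (x, y) >> : free).

(* The subgroup of the free abelian group on M * N generated by the bilinearity
   relations. *)
Inductive tensor_null : free -> Prop :=
| TensorNull0 : tensor_null 0
| TensorNullB g h : tensor_null g -> tensor_null h -> tensor_null (g - h)
| TensorNullDl x x' y : tensor_null (gen (x + x') y - gen x y - gen x' y)
| TensorNullDr x y y' : tensor_null (gen x (y + y') - gen x y - gen x y')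
| TensorNullZ a x y : tensor_null (gen (a *: x) y - gen x (a *: y)).

Definition tensor_nullb : {pred free} := [pred g | `[< tensor_null g >]].

Fact tensor_nullb_zmod_closed : zmod_closed tensor_nullb.
Proof.
split=> [|g h]; first by apply/asboolP; exact: TensorNull0.
by move=> /asboolP g0 /asboolP h0; apply/asboolP; exact: TensorNullB.
Qed.

HB.instance Definition _ :=
  GRing.isZmodClosed.Build free tensor_nullb tensor_nullb_zmod_closed.

Definition tensor := Quotient.quot tensor_nullb.

HB.instance Definition _ := GRing.Zmodule.on tensor.

Definition tens (x : M) (y : N) : tensor := \pi_(Quotient.quot tensor_nullb) << (x, y) >>.

End TensorProduct.

Section TensorMap.
Variables (R : comNzRingType) (M N N' : lmodType R) (f : N -> N').

Definition free_map : {freeg (M * N)%type / int} -> {freeg (M * N')%type / int} :=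
  fglift (fun p => << (p.1, f p.2) >>).

Fact free_map_is_zmod_morphism : zmod_morphism free_map.
Proof. exact: lift_is_additive. Qed.

HB.instance Definition _ :=
  GRing.isZmodMorphism.Build _ _ free_map free_map_is_zmod_morphism.

Fact free_map_gen x y : free_map << (x, y) >> = << (x, f y) >>.
Proof. by rewrite /free_map liftU scale1r. Qed.

(* id_M tensored with f; it only depends on the class of its argument when f is linear,
   see tensor_map_pi below. *)
Definition tensor_map (t : tensor M N) : tensor M N' :=
  \pi_(Quotient.quot (@tensor_nullb R M N')) (free_map (repr t)).

End TensorMap.

Section TensorMapTheory.
Variables (R : comNzRingType) (M N N' : lmodType R) (f : {linear N -> N'}).

Lemma free_map_null g : tensor_null g -> tensor_null (free_map (M := M) f g).
Proof.
elim=> [|{}g h _ IHg _ IHh|x x' y|x y y'|a x y].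
- by rewrite raddf0; exact: TensorNull0.
- by rewrite raddfB; exact: TensorNullB.
- by rewrite !raddfB /= !free_map_gen; exact: TensorNullDl.
- by rewrite !raddfB /= !free_map_gen linearD; exact: TensorNullDr.
- by rewrite raddfB /= !free_map_gen linearZ; exact: TensorNullZ.
Qed.

Lemma tensor_map_pi (g : {freeg (M * N)%type / int}) :
  tensor_map f (\pi_(Quotient.quot (@tensor_nullb R M N)) g) =
  \pi_(Quotient.quot (@tensor_nullb R M N')) (free_map f g).
Proof.
apply/eqP; rewrite /tensor_map eqmodE; apply/asboolP.
rewrite -raddfB; apply: free_map_null; apply/asboolP.
have : repr (\pi_(Quotient.quot (@tensor_nullb R M N)) g)
  == g %[mod Quotient.quot (@tensor_nullb R M N)] by rewrite reprK.
by rewrite eqmodE.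
Qed.

Lemma tensor_map_tens x y : tensor_map f (tens x y : tensor M N) = tens x (f y).
Proof. by rewrite tensor_map_pi free_map_gen. Qed.

Lemma tensor_map_is_zmod_morphism : zmod_morphism (tensor_map (M := M) f).
Proof.
move=> s t.
have -> : s - t = \pi_(Quotient.quot (@tensor_nullb R M N)) (repr s - repr t).
  by rewrite [RHS]raddfB; congr (_ - _); symmetry; exact: reprK.
by rewrite tensor_map_pi !raddfB.
Qed.

End TensorMapTheory.

Definition flat (R : comNzRingType) (M : lmodType R) : Prop :=
  forall (N N' : lmodType R) (f : {linear N -> N'}),
    injective f -> injective (tensor_map (M := M) f).

Section SubringType.
Variables (K : fieldType) (S : subringClosed K).

Definition subring_type : Type := {x : K | x \in S}.

HB.instance Definition _ := SubChoice.on subring_type.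
HB.instance Definition _ := [SubChoice_isSubComNzRing of subring_type by <:].

End SubringType.

(* Membership in a {pred K} is boolean; `[< _ >] turns a proposition into a
   boolean classically, so these predicates range over all subsets of K. *)
Section Colon.
Variable K : fieldType.

Definition colon (A B : {pred K}) : {pred K} :=
  [pred x | `[< forall y, y \in B -> x * y \in A >]].

Variable I : zmodClosed K.

Definition multiplier_ring : {pred K} := colon I I.

Fact multiplier_ring_subring_closed : subring_closed multiplier_ring.
Proof.
split=> [|x y|x y]; rewrite ?inE.
- by apply/asboolP => y Iy; rewrite mul1r.
- move=> /asboolP Ix /asboolP Iy; apply/asboolP => z Iz.
  by rewrite mulrBl rpredB ?Ix ?Iy.
- move=> /asboolP Ix /asboolP Iy; apply/asboolP => z Iz.
  by rewrite -mulrA Ix ?Iy.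
Qed.

HB.instance Definition _ :=
  GRing.isSubringClosed.Build K multiplier_ring multiplier_ring_subring_closed.

Definition ideal_module : Type := {x : K | x \in I}.

HB.instance Definition _ := SubChoice.on ideal_module.
HB.instance Definition _ := [SubChoice_isSubZmodule of ideal_module by <:].

Fact ideal_module_scale_subproof (a : subring_type multiplier_ring)
  (x : ideal_module) : val a * val x \in I.
Proof. by have /asboolP := valP a; apply; exact: valP. Qed.

Definition ideal_module_scale (a : subring_type multiplier_ring)
  (x : ideal_module) : ideal_module :=
  exist _ (val a * val x) (ideal_module_scale_subproof a x).

Fact ideal_module_scaleA a b x :
  ideal_module_scale a (ideal_module_scale b x) = ideal_module_scale (a * b) x.
Proof. by apply: val_inj; rewrite /= mulrA. Qed.

Fact ideal_module_scale1 : left_id 1 ideal_module_scale.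
Proof. by move=> x; apply: val_inj; rewrite /= mul1r. Qed.

Fact ideal_module_scaleDr : right_distributive ideal_module_scale +%R.
Proof. by move=> a x y; apply: val_inj; rewrite /= mulrDr. Qed.

Fact ideal_module_scaleDl x : {morph ideal_module_scale^~ x : a b / a + b}.
Proof. by move=> a b; apply: val_inj; rewrite /= mulrDl. Qed.

HB.instance Definition _ :=
  GRing.Zmodule_isLmodule.Build (subring_type multiplier_ring) ideal_module
    ideal_module_scaleA ideal_module_scale1 ideal_module_scaleDr
    ideal_module_scaleDl.

Definition quasi_stable_ideal : Prop := flat ideal_module.

End Colon.

(* A domain is a subring R of a field K; its overrings are then the subrings of
   K containing it, and all of them have K as quotient field when R does. *)
Section Domains.
Variables (K : fieldType) (R : subringClosed K).

Definition is_quotient_field : Prop :=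
  forall x : K, exists a b, [/\ a \in R, b \in R, b != 0 & x = a / b].

Definition integral_closure : {pred K} :=
  [pred x | `[< integralOver (val : subring_type R -> K) x >]].

Definition fractional_ideal (I : zmodClosed K) : Prop :=
  (forall a x, a \in R -> x \in I -> a * x \in I) /\
  (exists d, [/\ d \in R, d != 0 & forall x, x \in I -> d * x \in R]).

Definition quasi_stable : Prop :=
  forall I : zmodClosed K, fractional_ideal I ->
    (exists2 x, x \in I & x != 0) -> quasi_stable_ideal I.

End Domains.

(* Main.v *)
From HB Require Import structures.
Require Import Defs.
From mathcomp Require Import all_boot all_order all_algebra.
From mathcomp Require Import boolp freeg.
From mathcomp Require Import ring.

Set Implicit Arguments.
Unset Strict Implicit.
Unset Printing Implicit Defensive.

Import GRing.Theory.
Local Open Scope ring_scope.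
Local Open Scope quotient_scope.

(** Let T be an overring of D and I a nonzero ideal of T, with d I contained
    in T for some nonzero d in T. Only the quasi-stability of D is available,
    so the proof finds a fractional ideal J of D that generates I over T and
    transfers flatness from J to I.

    The candidate is J, the set of the x in I with d x integral over D
    ([contraction]). It is a fractional ideal of D because the integral
    closure has a nonzero conductor. To see that J generates I, take x in I
    and put t = d x, an element of T. The fractional ideal L = D + D t is flat
    over its multiplier ring E = (L : L). Now write t = p / q with p and q in
    D: a flat module in which p m = q n satisfies m \in ((q) : p) M
    ([flat_colon]), and here m = 1 and n = t, so that 1 = a + b t for some a
    and b in E with a t and b t in E ([flat_span1_invertible]; this says that
    L is invertible over E). As L contains 1, the ring E is contained in L,
    hence in T; as L is finitely generated over D and contains 1, the ring E
    is integral over D ([mult_span1_integral]). Therefore a x and b x are in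
    J, and x = a x + (b x) t is in J T.

    By hypothesis J is flat over A = (J : J), and J T = I implies that A is
    contained in B = (I : I). Multiplication maps J (x)_A B onto I, and it is
    injective because flatness of J embeds J (x)_A B in J (x)_A K, which is a
    line over the field K ([ideal_mul_inj]). So I is the base change of J to
    B, and base change preserves flatness ([flat_base_change]). *)

(** * Additive spans and tensor products *)

(** The subgroup generated by X, as an inductive predicate: a property of a
    tensor, or of an element of a product of ideals, is then proved by
    induction on generators. *)
Inductive add_span (V : zmodType) (X : V -> Prop) : V -> Prop :=
| AddSpanGen v of X v : add_span X v
| AddSpan0 : add_span X 0
| AddSpanB u v of add_span X u & add_span X v : add_span X (u - v).

Section AddSpanTheory.
Variable V : zmodType.
Implicit Types (X Y : V -> Prop) (u v : V).

Lemma add_spanN X u : add_span X u -> add_span X (- u).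
Proof. by move=> Xu; rewrite -sub0r; apply: AddSpanB Xu; exact: AddSpan0. Qed.

Lemma add_spanD X u v : add_span X u -> add_span X v -> add_span X (u + v).
Proof. by move=> Xu /add_spanN Xv; rewrite -[v]opprK; exact: AddSpanB. Qed.

End AddSpanTheory.

Lemma zmod_morphismD (U V : zmodType) (f : U -> V) :
  zmod_morphism f -> {morph f : x y / x + y}.
Proof.
by move=> fB x y; apply/eqP; rewrite -subr_eq -fB addrK.
Qed.

Section Tensor.
Variables (R : comNzRingType) (M N : lmodType R).
Local Notation free := {freeg (M * N)%type / int}.
Local Notation pi := (\pi_(Quotient.quot (@tensor_nullb R M N))).

Lemma free_add_span (g : free) :
  add_span (fun h => exists z, h = << z >>) g.
Proof.
rewrite -[g]freeg_sumE; elim/big_rec: _ => [|z h _ Sh]; first exact: AddSpan0.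
apply: add_spanD Sh.
have Sn n : add_span (fun h : free => exists z, h = << z >>) << n%:Z *g z >>.
  elim: n => [|n IHn]; first by rewrite freegU0; exact: AddSpan0.
  rewrite -addn1 PoszD -freegUD; apply: add_spanD IHn _.
  by apply: AddSpanGen; exists z.
case: (coeff z g) => n; first exact: Sn.
by rewrite NegzE -freegUN; exact: add_spanN.
Qed.

Lemma tensor_add_span (t : tensor M N) :
  add_span (fun u => exists x y, u = tens x y) t.
Proof.
have -> : t = pi (repr t) by symmetry; exact: reprK.
elim: (free_add_span (repr t)) => [_ [[x y] ->]||g h _ Sg _ Sh].
- by apply: AddSpanGen; exists x, y.
- by rewrite raddf0; exact: AddSpan0.
- by rewrite raddfB; exact: AddSpanB.
Qed.

Lemma eq_tens g h : tensor_null (g - h) -> pi g = pi h.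
Proof. by move=> gh0; apply/eqP; rewrite eqmodE; apply/asboolP. Qed.

Lemma tensDl x x' y : tens (x + x') y = tens x y + tens x' y :> tensor M N.
Proof.
rewrite -[RHS]raddfD; apply: eq_tens; rewrite opprD addrA.
exact: TensorNullDl.
Qed.

Lemma tensDr x y y' : tens x (y + y') = tens x y + tens x y' :> tensor M N.
Proof.
rewrite -[RHS]raddfD; apply: eq_tens; rewrite opprD addrA.
exact: TensorNullDr.
Qed.

Lemma tensZ a x y : tens (a *: x) y = tens x (a *: y) :> tensor M N.
Proof. by apply: eq_tens; exact: TensorNullZ. Qed.

Lemma tens0r x : tens x 0 = 0 :> tensor M N.
Proof. by apply: (addrI (tens x 0)); rewrite -tensDr !addr0. Qed.

End Tensor.

Section TensorLift.
Variables (R : comNzRingType) (M N : lmodType R) (V : zmodType).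
Local Notation free := {freeg (M * N)%type / int}.
Variable b : M -> N -> V.

(* The lift to the free abelian group needs an int-module as its target, which
   zmodule V supplies. *)
Definition free_lift (g : free) : V :=
  fglift (fun p => b p.1 p.2 : zmodule V) g.

Fact free_lift_is_zmod_morphism : zmod_morphism free_lift.
Proof.
exact: (@lift_is_additive _ _ (zmodule V) (fun p => b p.1 p.2 : zmodule V)).
Qed.

HB.instance Definition _ :=
  GRing.isZmodMorphism.Build free V free_lift free_lift_is_zmod_morphism.

Fact free_lift_gen x y : free_lift << (x, y) >> = b x y.
Proof. by rewrite /free_lift liftU scale1r. Qed.

(** The universal property in a form that does not mention quotients of V: a
    map that is balanced bilinear modulo the subgroup spanned by X sends the
    relations of the tensor product into that subgroup. The case where X
    contains only 0 gives [tensor_lift]. *)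
Lemma tensor_null_lift (X : V -> Prop) :
    (forall x x' y, add_span X (b (x + x') y - b x y - b x' y)) ->
    (forall x y y', add_span X (b x (y + y') - b x y - b x y')) ->
    (forall a x y, add_span X (b (a *: x) y - b x (a *: y))) ->
  forall g, tensor_null g -> add_span X (free_lift g).
Proof.
move=> bDl bDr bZ g; elim=> [|{}g h _ Sg _ Sh|x x' y|x y y'|a x y].
- by rewrite raddf0; exact: AddSpan0.
- by rewrite raddfB; exact: AddSpanB.
- by rewrite !raddfB /= !free_lift_gen.
- by rewrite !raddfB /= !free_lift_gen.
- by rewrite raddfB /= !free_lift_gen.
Qed.

Definition tensor_lift (t : tensor M N) : V := free_lift (repr t).

Hypothesis bDl : forall x x' y, b (x + x') y = b x y + b x' y.
Hypothesis bDr : forall x y y', b x (y + y') = b x y + b x y'.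
Hypothesis bZ : forall a x y, b (a *: x) y = b x (a *: y).

Lemma tensor_lift_pi g :
  tensor_lift (\pi_(Quotient.quot (@tensor_nullb R M N)) g) = free_lift g.
Proof.
apply/eqP; rewrite -subr_eq0 /tensor_lift -raddfB; apply/eqP.
have span0 w : add_span (fun v : V => v = 0) w -> w = 0.
  by elim=> // u v _ -> _ ->; rewrite subr0.
apply: span0; apply: tensor_null_lift => [x x' y|x y y'|a x y|].
- by rewrite bDl addrAC addrK subrr; exact: AddSpan0.
- by rewrite bDr addrAC addrK subrr; exact: AddSpan0.
- by rewrite bZ subrr; exact: AddSpan0.
apply/asboolP; have : repr (\pi_(Quotient.quot (@tensor_nullb R M N)) g)
  == g %[mod Quotient.quot (@tensor_nullb R M N)] by rewrite reprK.
by rewrite eqmodE.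
Qed.

Lemma tensor_lift_tens x y : tensor_lift (tens x y) = b x y.
Proof. by rewrite tensor_lift_pi free_lift_gen. Qed.

Lemma tensor_lift_is_zmod_morphism : zmod_morphism tensor_lift.
Proof.
move=> s t.
have -> : s - t = \pi_(Quotient.quot (@tensor_nullb R M N)) (repr s - repr t).
  by rewrite [RHS]raddfB; congr (_ - _); symmetry; exact: reprK.
by rewrite tensor_lift_pi raddfB.
Qed.

End TensorLift.

Section TensorExt.
Variables (R : comNzRingType) (M N : lmodType R) (V : zmodType).

Lemma eq_tensor_map_on (f g : tensor M N -> V) :
    zmod_morphism f -> zmod_morphism g ->
  (forall x y, f (tens x y) = g (tens x y)) -> f =1 g.
Proof.
move=> fB gB eqfg t.
elim: (tensor_add_span t) => [_ [x [y ->]]//||u v _ fu _ fv].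
  by rewrite -(subrr 0) fB gB !subrr.
by rewrite fB gB fu fv.
Qed.

End TensorExt.

(** * A two-term relation in a flat module *)

Section PairIdeal.
Variables (R : comNzRingType) (p q : R).

Definition pair_ideal : {pred R^o} :=
  [pred j | `[< exists e e', j = p * e + q * e' >]].

Fact pair_ideal_submod_closed : submod_closed pair_ideal.
Proof.
split=> [|a _ _ /asboolP[e [e' ->]] /asboolP[d [d' ->]]]; apply/asboolP.
  by exists 0, 0; rewrite !mulr0 addr0.
exists (a * e + d), (a * e' + d').
by rewrite /GRing.scale /= !mulrDr addrACA !(mulrCA a).
Qed.

HB.instance Definition _ :=
  GRing.isSubmodClosed.Build R R^o pair_ideal pair_ideal_submod_closed.

Definition pair_ideal_module : Type := {j : R^o | j \in pair_ideal}.

HB.instance Definition _ := SubChoice.on pair_ideal_module.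
HB.instance Definition _ := [SubChoice_isSubLmodule of pair_ideal_module by <:].

Fact pair_ideal_in e e' : p * e + q * e' \in pair_ideal.
Proof. by apply/asboolP; exists e, e'. Qed.

Definition pair_ideal_elt e e' : pair_ideal_module :=
  exist _ (p * e + q * e') (pair_ideal_in e e').

Fact pair_ideal_coef_subproof (j : pair_ideal_module) :
  exists e, exists e', val j = p * e + q * e'.
Proof. by have /asboolP := valP j. Qed.

(** A coefficient of p chosen for each j in pR + qR; it is determined only
    modulo the colon ideal of the a with p a in qR. *)
Definition pair_ideal_coef (j : pair_ideal_module) : R :=
  projT1 (cid (pair_ideal_coef_subproof j)).

Lemma pair_ideal_coefP j : exists e', val j = p * pair_ideal_coef j + q * e'.
Proof. exact: (projT2 (cid (pair_ideal_coef_subproof j))). Qed.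

End PairIdeal.

(** By flatness the relation already holds inside the ideal J = pR + qR: in
    M (x) J one has m (x) p = n (x) q, because both sides become
    p m (x) 1 = q n (x) 1 in M (x) R. Reading off the coefficient of p, which
    is well defined modulo the colon ideal C = (q) : p, gives a map from
    M (x) J to M / C M that sends m (x) p to m and n (x) q to 0. *)
Lemma flat_colon (R : comNzRingType) (M : lmodType R) (p q : R) (m n : M) :
    flat M -> p *: m = q *: n ->
  add_span (fun v => exists a c w, p * a = q * c /\ v = a *: w) m.
Proof.
move=> flatM pm_qn; set X := (X in add_span X _).
pose J := pair_ideal_module p q.
pose jp : J := pair_ideal_elt p q 1 0; pose jq : J := pair_ideal_elt p q 0 1.
pose s : J -> R := @pair_ideal_coef R p q.
have sE j : exists c, p * s j = val j - q * c.
  by have [c ->] := pair_ideal_coefP j; exists c; rewrite addrK.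
have sX d c x : p * d = q * c -> add_span X (d *: x).
  by move=> pd_qc; apply: AddSpanGen; exists d, c, x.
have vjp : val jp = p by rewrite /= mulr1 mulr0 addr0.
have vjq : val jq = q by rewrite /= mulr1 mulr0 add0r.
have jpq : tens m jp = tens n jq :> tensor M J.
  apply: (flatM _ _ (val : {linear J -> R^o}) val_inj).
  have scale1 (a : R) : a = a *: (1 : R^o) by rewrite /GRing.scale /= mulr1.
  rewrite !tensor_map_tens [X in tens m X]vjp [X in tens n X]vjq.
  by rewrite [X in tens m X]scale1 [X in tens n X]scale1 -!tensZ pm_qn.
have : tensor_null (<< (m, jp) >> - << (n, jq) >> : {freeg (M * J)%type / int}).
  move/eqP: jpq; rewrite /tens eqmodE; by move/asboolP.
move=> /(@tensor_null_lift _ _ _ M (fun x j => s j *: x) X) mn0.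
have {mn0}: add_span X (s jp *: m - s jq *: n).
  rewrite -!(free_lift_gen (fun x j => s j *: x)) -raddfB.
  apply: mn0 => [x x' y|x y y'|a x y].
  - by rewrite scalerDr addrAC addrK subrr; exact: AddSpan0.
  - rewrite -!scalerBl; have [c cE] := sE (y + y').
    have [[c1 c1E] [c2 c2E]] := (sE y, sE y').
    by apply: (sX _ (c1 + c2 - c)); rewrite !mulrBr cE c1E c2E /=; ring.
  - rewrite scalerA -scalerBl; have [[c cE] [c1 c1E]] := (sE y, sE (a *: y)).
    apply: (sX _ (c1 - a * c)); rewrite mulrBr c1E mulrA cE linearZ /=.
    by rewrite /GRing.scale /=; ring.
(* The coefficients of p in p and in q are 1 and 0 modulo the colon ideal. *)
have [[c cE] [c1 c1E]] := (sE jp, sE jq).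
rewrite vjp vjq in cE c1E => mn.
have -> : m = (1 - s jp) *: m + s jq *: n + (s jp *: m - s jq *: n).
  by rewrite scalerBl scale1r addrACA subrK subrr addr0.
apply: add_spanD mn; apply: add_spanD.
  by apply: (sX _ c); rewrite mulrBr cE mulr1; ring.
by rewrite -[_ *: n]opprK -scaleNr; apply/add_spanN/(sX _ (c1 - 1));
  rewrite mulrN c1E; ring.
Qed.

(** * Restriction of scalars and base change *)

(** N itself; phi occurs only to let the A-module structure be inferred. *)
Definition restrict_scalars (A B : comNzRingType) (phi : {rmorphism A -> B})
  (N : lmodType B) : Type := N.

Section RestrictScalars.
Variables (A B : comNzRingType) (phi : {rmorphism A -> B}).
Local Notation restrict N := (restrict_scalars phi N).

Section Module.
Variable N : lmodType B.

HB.instance Definition _ := GRing.Zmodule.on (restrict N).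

Definition restrict_scale (a : A) (x : restrict N) :
  restrict N := phi a *: (x : N).

Fact restrict_scaleA a b x :
  restrict_scale a (restrict_scale b x) = restrict_scale (a * b) x.
Proof. by rewrite /restrict_scale scalerA rmorphM. Qed.

Fact restrict_scale1 : left_id 1 restrict_scale.
Proof. by move=> x; rewrite /restrict_scale rmorph1 scale1r. Qed.

Fact restrict_scaleDr : right_distributive restrict_scale +%R.
Proof. by move=> a x y; rewrite /restrict_scale -scalerDr. Qed.

Fact restrict_scaleDl x : {morph restrict_scale^~ x : a b / a + b}.
Proof. by move=> a b; rewrite /restrict_scale rmorphD scalerDl. Qed.

HB.instance Definition _ :=
  GRing.Zmodule_isLmodule.Build A (restrict N)
    restrict_scaleA restrict_scale1 restrict_scaleDr restrict_scaleDl.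

End Module.

Section OrbitMap.
Variable N : lmodType B.

Definition orbit_map (x : N) (b : restrict B^o) : restrict N :=
  (b : B) *: x.

Fact orbit_map_is_linear x : linear (orbit_map x).
Proof. by move=> a b c; rewrite /orbit_map scalerDl -scalerA. Qed.

HB.instance Definition _ x :=
  GRing.isLinear.Build A (restrict B^o) (restrict N) _
    (orbit_map x) (orbit_map_is_linear x).

End OrbitMap.

Definition restrict_map (N N' : lmodType B) (f : N -> N') :
  restrict N -> restrict N' := f.

Section Map.
Variables (N N' : lmodType B) (f : {linear N -> N'}).

Fact restrict_map_is_linear : linear (restrict_map f).
Proof. by move=> a x y; rewrite /restrict_map linearP. Qed.

HB.instance Definition _ :=
  GRing.isLinear.Build A (restrict N) (restrict N') _
    (restrict_map f) restrict_map_is_linear.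
End Map.

End RestrictScalars.

Section BaseChange.
Variables (A B : comNzRingType) (phi : {rmorphism A -> B}).
Variables (M : lmodType A) (P : lmodType B) (iota : M -> P).
Local Notation restrict N := (restrict_scalars phi N).
Hypothesis iotaB : zmod_morphism iota.
Hypothesis iotaZ : forall a x, iota (a *: x) = phi a *: iota x.

(** The canonical map from the extension of scalars of M to P. *)
Definition extension_map : tensor M (restrict B^o) -> P :=
  tensor_lift (fun x (b : restrict B^o) => (b : B) *: iota x).

Let iotaD := zmod_morphismD iotaB.

Let extDl (x x' : M) (b : restrict B^o) :
  (b : B) *: iota (x + x') = (b : B) *: iota x + (b : B) *: iota x'.
Proof. by rewrite iotaD scalerDr. Qed.
Let extDr (x : M) (b b' : restrict B^o) :
  (b + b' : B) *: iota x = (b : B) *: iota x + (b' : B) *: iota x.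
Proof. exact: scalerDl. Qed.
Let extZ (a : A) (x : M) (b : restrict B^o) :
  (b : B) *: iota (a *: x) = ((a *: b : restrict B^o) : B) *: iota x.
Proof. by rewrite iotaZ scalerA mulrC. Qed.

Lemma extension_map_tens x (b : B) :
  extension_map (tens x (b : restrict B^o)) = b *: iota x.
Proof. exact: tensor_lift_tens. Qed.

Lemma extension_map_is_zmod_morphism : zmod_morphism extension_map.
Proof. exact: tensor_lift_is_zmod_morphism. Qed.

Section Descend.
Variable N : lmodType B.

(** The map from M (x)_A N to P (x)_B N induced by iota. *)
Definition descend_tensor : tensor M (restrict N) -> tensor P N :=
  tensor_lift (fun x (n : restrict N) => tens (iota x) (n : N)).

Lemma descend_tensor_is_zmod_morphism : zmod_morphism descend_tensor.
Proof.
apply: tensor_lift_is_zmod_morphism => [x x' y|x y y'|a x y].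
- by rewrite iotaD tensDl.
- exact: tensDr.
- by rewrite iotaZ tensZ.
Qed.

Lemma descend_tensor_tens x (n : N) :
  descend_tensor (tens x (n : restrict N)) = tens (iota x) n.
Proof.
pose b x (z : restrict N) : tensor P N := tens (iota x) (z : N).
apply: (tensor_lift_tens (b := b)); rewrite /b.
- by move=> y y' z; rewrite iotaD tensDl.
- by move=> y z z'; exact: tensDr.
- by move=> a y z; rewrite iotaZ tensZ.
Qed.

Lemma descend_tensor_orbit (n : N) (t : tensor M (restrict B^o)) :
  descend_tensor (tensor_map (orbit_map (phi := phi) n) t) =
  tens (extension_map t) n.
Proof.
move: t; apply: eq_tensor_map_on => [s t|s t|x b].
- by rewrite tensor_map_is_zmod_morphism descend_tensor_is_zmod_morphism.
- rewrite extension_map_is_zmod_morphism.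
  apply: (addIr (tens (extension_map t) n)).
  by rewrite subrK -tensDl subrK.
- by rewrite tensor_map_tens descend_tensor_tens extension_map_tens tensZ.
Qed.

End Descend.
End BaseChange.

Section FlatBaseChange.
Variables (A B : comNzRingType) (phi : {rmorphism A -> B}).
Variables (M : lmodType A) (P : lmodType B) (iota : M -> P).
Local Notation restrict N := (restrict_scalars phi N).
Local Notation ext := (@extension_map A B phi M P iota).
Local Notation orbit x := (orbit_map (phi := phi) x).
Hypothesis iotaB : zmod_morphism iota.
Hypothesis iotaZ : forall a x, iota (a *: x) = phi a *: iota x.
Hypothesis ext_inj : injective ext.
Hypothesis ext_surj : forall p, exists t, ext t = p.

Let extB : zmod_morphism ext := extension_map_is_zmod_morphism iotaB iotaZ.

Lemma extension_inverse : exists nu : P -> tensor M (restrict B^o),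
  [/\ cancel nu ext, forall p p', nu (p + p') = nu p + nu p'
    & forall b p, nu (b *: p) = tensor_map (orbit (b : B^o)) (nu p)].
Proof.
have [nu nuK] : exists nu, cancel nu ext.
  exists (fun p => projT1 (cid (ext_surj p))) => p.
  exact: (projT2 (cid (ext_surj p))).
exists nu; split=> // [p p'|b p]; apply: ext_inj; rewrite nuK.
  by rewrite (zmod_morphismD extB) !nuK.
rewrite -{1}(nuK p); move: (nu p); apply: eq_tensor_map_on => [s t|s t|x c].
- by rewrite extB scalerBr.
- by rewrite tensor_map_is_zmod_morphism extB.
- by rewrite tensor_map_tens !extension_map_tens // scalerA mulrC.
Qed.

(** When P is the extension of scalars of M, the B-module P (x)_B N is
    M (x)_A N up to an isomorphism that is natural in N, so that tensoring
    with P preserves injections as soon as tensoring with M does. The map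
    from left to right takes p (x) n to the image of p, read in M (x)_A B,
    under b |-> b n; its left inverse is [descend_tensor]. *)
Lemma flat_base_change : flat M -> flat P.
Proof.
move=> flatM N N' f f_inj; have [nu [nuK nuD nuZ]] := extension_inverse.
pose c (L : lmodType B) p (y : L) := tensor_map (orbit y) (nu p).
have cDl (L : lmodType B) p p' (y : L) : c L (p + p') y = c L p y + c L p' y.
  rewrite /c nuD; apply: zmod_morphismD.
  exact: tensor_map_is_zmod_morphism.
have cDr (L : lmodType B) p (y y' : L) : c L p (y + y') = c L p y + c L p y'.
  rewrite /c; move: (nu p); apply: eq_tensor_map_on => [s t|s t|x b].
  - exact: tensor_map_is_zmod_morphism.
  - by rewrite !tensor_map_is_zmod_morphism opprD addrACA.
  - by rewrite !tensor_map_tens -tensDr /= /orbit_map scalerDr.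
have cZ (L : lmodType B) b p (y : L) : c L (b *: p) y = c L p (b *: y).
  rewrite /c nuZ; move: (nu p); apply: eq_tensor_map_on => [s t|s t|x d].
  - by rewrite !tensor_map_is_zmod_morphism.
  - exact: tensor_map_is_zmod_morphism.
  - by rewrite !tensor_map_tens /= /orbit_map scalerA.
pose lift (L : lmodType B) := tensor_lift (c L).
have liftB (L : lmodType B) : zmod_morphism (lift L).
  exact: (tensor_lift_is_zmod_morphism (@cDl L) (@cDr L) (@cZ L)).
have lift_tens (L : lmodType B) p (y : L) : lift L (tens p y) = c L p y.
  exact: (tensor_lift_tens (@cDl L) (@cDr L) (@cZ L)).
have liftK (L : lmodType B) :
    cancel (lift L) (@descend_tensor A B phi M P iota L).
  have dB := descend_tensor_is_zmod_morphism iotaB iotaZ.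
  apply: eq_tensor_map_on => [s t|//|p y]; first by rewrite liftB dB.
  by rewrite lift_tens descend_tensor_orbit // nuK.
have lift_nat (t : tensor P N) :
    lift N' (tensor_map f t) = tensor_map (restrict_map f) (lift N t).
  move: t; apply: eq_tensor_map_on => [s t|s t|p y].
  - by rewrite tensor_map_is_zmod_morphism liftB.
  - by rewrite liftB tensor_map_is_zmod_morphism.
  - rewrite tensor_map_tens !lift_tens /c; move: (nu p).
    apply: eq_tensor_map_on => [s t|s t|x b].
    + exact: tensor_map_is_zmod_morphism.
    + by rewrite !tensor_map_is_zmod_morphism.
    + by rewrite !tensor_map_tens /= /orbit_map /restrict_map linearZ.
move=> u v /(congr1 (lift N')); rewrite !lift_nat.
by move/(flatM _ _ (restrict_map f : {linear restrict N -> restrict N'}) f_inj)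
  /(can_inj (liftK N)).
Qed.

End FlatBaseChange.

(** * Flatness of extended ideals *)

Section SubringInclusion.
Variables (K : fieldType) (S S' : subringClosed K).
Hypothesis sSS' : {subset S <= S'}.

Definition subring_incl (a : subring_type S) : subring_type S' :=
  exist _ (val a) (sSS' (valP a)).

Fact subring_incl_is_zmod_morphism : zmod_morphism subring_incl.
Proof. by move=> a b; apply: val_inj. Qed.

Fact subring_incl_is_monoid_morphism : monoid_morphism subring_incl.
Proof. by split=> [|a b]; apply: val_inj. Qed.

HB.instance Definition _ :=
  GRing.isZmodMorphism.Build (subring_type S) (subring_type S') subring_incl
    subring_incl_is_zmod_morphism.
HB.instance Definition _ :=
  GRing.isMonoidMorphism.Build (subring_type S) (subring_type S') subring_incl
    subring_incl_is_monoid_morphism.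

End SubringInclusion.

Section TensorFractionField.
Variables (K : fieldType) (J : zmodClosed K).
Local Notation A := (subring_type (multiplier_ring J)).
Local Notation valA := (val : {rmorphism A -> K}).
Local Notation KA := (restrict_scalars valA K^o).
Hypothesis fracA : is_quotient_field (multiplier_ring J).

Definition ideal_mul : tensor (ideal_module J) KA -> K :=
  tensor_lift (fun (x : ideal_module J) (k : KA) => val x * (k : K)).

Fact ideal_mul_tens x (k : KA) : ideal_mul (tens x k) = val x * (k : K).
Proof.
pose b (y : ideal_module J) (z : KA) : K := val y * (z : K).
apply: (tensor_lift_tens (b := b)); rewrite /b.
- by move=> y y' z; rewrite -mulrDl.
- by move=> y z z'; rewrite -mulrDr.
- by move=> a y z; rewrite mulrCA mulrA.
Qed.

Fact ideal_mul_is_zmod_morphism : zmod_morphism ideal_mul.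
Proof.
apply: tensor_lift_is_zmod_morphism => [y y' z|y z z'|a y z].
- by rewrite -mulrDl.
- by rewrite -mulrDr.
- by rewrite mulrCA mulrA.
Qed.

(** Denominators move across the tensor sign, so that every tensor is
    x0 (x) k for one fixed nonzero x0. *)
Lemma ideal_mul_inj (x0 : ideal_module J) : val x0 != 0 -> injective ideal_mul.
Proof.
move=> x0_neq0.
have tens_x0 t : exists k : KA, t = tens x0 k.
  elim: (tensor_add_span t) => [_ [x [k ->]]||_ _ _ [k ->] _ [k' ->]].
  - have [r [s [Ar As s_neq0 rs]]] := fracA (val x / val x0).
    pose a : A := exist _ r Ar; pose b : A := exist _ s As.
    have bx : b *: x = a *: x0.
      apply: val_inj => /=; rewrite -[val x](divfK x0_neq0) rs.
      by rewrite mulrA mulrCA divff // mulr1.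
    exists (a *: (((k : K) / s : K) : KA)); rewrite -tensZ -bx tensZ.
    by congr tens; rewrite [RHS]mulrC divfK.
  - by exists 0; rewrite tens0r.
  - exists (k - k'); apply: (addIr (tens x0 k')).
    by rewrite subrK -tensDr subrK.
move=> u v; have [[k ->] [k' ->]] := (tens_x0 u, tens_x0 v).
by rewrite !ideal_mul_tens => /(mulfI x0_neq0) ->.
Qed.

End TensorFractionField.

Section FlatExtension.
Variables (K : fieldType) (J I : zmodClosed K).
Hypothesis fracJ : is_quotient_field (multiplier_ring J).
Hypothesis sJI : {subset J <= I}.
Hypothesis sAB : {subset multiplier_ring J <= multiplier_ring I}.
Hypothesis J_neq0 : exists2 x, x \in J & x != 0.
Hypothesis genI : forall x, x \in I ->
  add_span (fun v => exists y b,
    [/\ y \in J, b \in multiplier_ring I & v = y * b]) x.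
Local Notation A := (subring_type (multiplier_ring J)).
Local Notation B := (subring_type (multiplier_ring I)).
Local Notation phi := (subring_incl sAB : {rmorphism A -> B}).
Local Notation valA := (val : {rmorphism A -> K}).
Local Notation KA := (restrict_scalars valA K^o).
Local Notation BA := (restrict_scalars phi B^o).

Definition ring_in_field (b : BA) : KA := val (b : B).

Fact ring_in_field_is_linear : linear ring_in_field.
Proof. by []. Qed.

HB.instance Definition _ :=
  GRing.isLinear.Build A BA KA _ ring_in_field ring_in_field_is_linear.

(** I is the base change of J to (I : I): multiplication is onto I by
    hypothesis, and it is injective because, by flatness of J, the tensor
    product of J with (I : I) embeds in the tensor product of J with K. *)
Lemma quasi_stable_ideal_extension :
  quasi_stable_ideal J -> quasi_stable_ideal I.
Proof.
move=> flatJ.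
pose iota (x : ideal_module J) : ideal_module I :=
  exist _ (val x) (sJI (valP x)).
have iotaB : zmod_morphism iota by move=> x y; apply: val_inj.
have iotaZ (a : A) x : iota (a *: x) = phi a *: iota x by apply: val_inj.
pose ext := extension_map (phi := phi) iota.
have extB : zmod_morphism ext := extension_map_is_zmod_morphism iotaB iotaZ.
have val_ext t : val (ext t) = ideal_mul (tensor_map ring_in_field t).
  move: t; apply: eq_tensor_map_on => [s t|s t|x b].
  - by rewrite extB raddfB.
  - by rewrite tensor_map_is_zmod_morphism ideal_mul_is_zmod_morphism.
  - by rewrite tensor_map_tens ideal_mul_tens /ext extension_map_tens //= mulrC.
apply: (flat_base_change iotaB iotaZ _ _ flatJ) => [s t|x].
  move/(congr1 val); rewrite !val_ext.
  have [x0 Jx0 x0_neq0] := J_neq0.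
  move/(ideal_mul_inj fracJ (x0 := exist _ x0 Jx0) x0_neq0).
  exact: (flatJ _ _ (ring_in_field : {linear BA -> KA}) val_inj).
suff [t /val_inj xE] : exists t, val (ext t) = val x by exists t.
elim: (genI (valP x)) => [_ [y [b [Jy Ib ->]]]||_ _ _ [s <-] _ [t <-]].
- exists (tens (exist _ y Jy : ideal_module J) (exist _ b Ib : BA)).
  by rewrite /ext extension_map_tens //= mulrC.
- by exists (0 - 0); rewrite extB subrr.
- by exists (s - t); rewrite (extB s t) raddfB.
Qed.

End FlatExtension.

(** * The fractional ideal D + D t *)

Section QuasiStable.
Variables (K : fieldType) (D : subringClosed K).
Implicit Types (t x y : K).

Definition span1 t : {pred K} :=
  [pred x | `[< exists u v, [/\ u \in D, v \in D & x = u + v * t] >]].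

Fact span1_zmod_closed t : zmod_closed (span1 t).
Proof.
split=> [|x y /asboolP[u [v [Du Dv ->]]] /asboolP[u' [v' [Du' Dv' ->]]]].
  by apply/asboolP; exists 0, 0; rewrite rpred0 mul0r addr0.
apply/asboolP; exists (u - u'), (v - v'); split; rewrite ?rpredB //.
by rewrite mulrBl opprD addrACA.
Qed.

HB.instance Definition _ t :=
  GRing.isZmodClosed.Build K (span1 t) (span1_zmod_closed t).

Lemma span1_in t u v : u \in D -> v \in D -> u + v * t \in span1 t.
Proof. by move=> Du Dv; apply/asboolP; exists u, v. Qed.

Lemma one_in_span1 t : 1 \in span1 t.
Proof. by rewrite -[1](addr0 1) -(mul0r t) span1_in ?rpred1 ?rpred0. Qed.

Lemma gen_in_span1 t : t \in span1 t.
Proof.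
by rewrite -[X in X \in _]add0r -[X in 0 + X]mul1r span1_in ?rpred1 ?rpred0.
Qed.

Lemma mult_span1_sub t : {subset multiplier_ring (span1 t) <= span1 t}.
Proof. by move=> e /asboolP/(_ 1 (one_in_span1 t)); rewrite mulr1. Qed.

(** Multiplication by e is an endomorphism of D + D t. From e = u + v t and
    e t = r + s t one gets that e is a root of (X - u) (X - s) - v r, the
    characteristic polynomial of its matrix on 1 and t. *)
Lemma mult_span1_integral t :
  {subset multiplier_ring (span1 t) <= integral_closure D}.
Proof.
move=> e /asboolP Ee; apply/asboolP.
have /asboolP[u [v [Du Dv eE]]] := Ee 1 (one_in_span1 t); rewrite mulr1 in eE.
have /asboolP[r [s [Dr Ds etE]]] := Ee t (gen_in_span1 t).
pose inD c (Dc : c \in D) : subring_type D := exist _ c Dc.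
pose c := inD _ (rpredM Dv Dr).
pose p := ('X - (inD _ Du)%:P) * ('X - (inD _ Ds)%:P).
have mon_p : p \is monic by rewrite monicMl ?monicXsubC.
have size_p : size p = 3.
  by rewrite size_Mmonic ?monicXsubC ?size_XsubC // monic_neq0 ?monicXsubC.
exists (p - c%:P).
  rewrite monicE lead_coefDl -?monicE // size_p size_polyN.
  exact: leq_ltn_trans (size_polyC_leq1 _) _.
(* With val abstracted as f, simplification keeps its morphism structure. *)
have [f vE] : exists f : {rmorphism subring_type D -> K},
    (val : subring_type D -> K) = f by exists val.
rewrite vE /root rmorphB rmorphM !rmorphB /= !map_polyX !map_polyC /=.
rewrite !hornerE -vE /=.
rewrite [X in (X - u) * _]eE [u + _]addrC addrK -mulrA [t * _]mulrC mulrBl.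
by rewrite etE addrK subrr.
Qed.

Lemma fractional_span1 t : is_quotient_field D -> fractional_ideal D (span1 t).
Proof.
move=> fracD; split=> [a x Da /asboolP[u [v [Du Dv ->]]]|].
  by rewrite mulrDr mulrA span1_in ?rpredM.
have [p [q [Dp Dq q_neq0 ->]]] := fracD t; exists q; split=> // x.
move=> /asboolP[u [v [Du Dv ->]]].
rewrite mulrDr mulrCA [q * (p / q)]mulrC divfK //.
by rewrite rpredD ?rpredM.
Qed.

Lemma mult_fractional (I : zmodClosed K) :
  fractional_ideal D I -> {subset D <= multiplier_ring I}.
Proof. by case=> ID _ a Da; apply/asboolP => x; exact: ID. Qed.

(** The conclusion says that D + D t is invertible over its multiplier ring E:
    a and b lie in the inverse of D + D t. With t = p / q, the relation
    p 1 = q t in the flat module D + D t gives 1 as a sum of products e w,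
    where w is in D + D t and q divides p e in E, that is, e t is in E. *)
Lemma flat_span1_invertible t : is_quotient_field D ->
    quasi_stable_ideal (span1 t) ->
  exists a b, [/\ a + b * t = 1,
    a \in multiplier_ring (span1 t), a * t \in multiplier_ring (span1 t),
    b \in multiplier_ring (span1 t) & b * t \in multiplier_ring (span1 t)].
Proof.
move=> fracD flatL; set E := multiplier_ring (span1 t).
have sDE : {subset D <= E} := mult_fractional (fractional_span1 t fracD).
have [p [q [Dp Dq q_neq0 tE]]] := fracD t.
pose pE : subring_type E := exist _ p (sDE p Dp).
pose qE : subring_type E := exist _ q (sDE q Dq).
pose one : ideal_module (span1 t) := exist _ 1 (one_in_span1 t).
pose gen : ideal_module (span1 t) := exist _ t (gen_in_span1 t).
have qt : q * t = p by rewrite tE mulrC divfK.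
have pq : pE *: one = qE *: gen.
  by apply: val_inj => /=; rewrite mulr1 qt.
suff: exists a b, [/\ a + b * t = val one,
    a \in E, a * t \in E, b \in E & b * t \in E] by [].
elim: (flat_colon flatL pq) => [_ [e [c [w [pe_qc ->]]]]||x y _ Gx _ Gy].
- have et : val e * t = val c.
    apply: (mulfI q_neq0); rewrite mulrCA qt mulrC.
    exact: (congr1 val pe_qc).
  have /asboolP[u [v [Du Dv wE]]] := valP w.
  have eK (y : K) : y * (u + v * t) = y * u + y * v * t by rewrite mulrDr mulrA.
  have vE : val (e *: w) = val e * u + val e * v * t by rewrite -eK -wE.
  have [Ee Ec Eu Ev] : [/\ val e \in E, val c \in E, u \in E & v \in E].
    by split; [exact: valP | exact: valP | exact: (sDE u) | exact: (sDE v)].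
  exists (val e * u), (val e * v); split; first exact: esym.
  + exact: rpredM.
  + by rewrite mulrAC et; exact: rpredM.
  + exact: rpredM.
  + by rewrite mulrAC et; exact: rpredM.
- by exists 0, 0; rewrite !mul0r addr0; split; rewrite ?rpred0.
- have [a [b [ab Ea Eat Eb Ebt]]] := Gx.
  have [a' [b' [ab' Ea' Eat' Eb' Ebt']]] := Gy.
  exists (a - a'), (b - b'); rewrite !mulrBl !rpredB //; split=> //.
  by rewrite raddfB /= -ab -ab' opprD addrACA.
Qed.

(** As D + D t contains 1, its multiplier ring lies in D + D t, hence in T, and
    it is integral over D. *)
Lemma overring_unit_decomposition (T : subringClosed K) t :
    is_quotient_field D -> quasi_stable D -> {subset D <= T} -> t \in T ->
  exists a b, [/\ a + b * t = 1, a \in T, b \in T,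
    a * t \in integral_closure D & b * t \in integral_closure D].
Proof.
move=> fracD stabD sDT Tt.
have flatL : quasi_stable_ideal (span1 t).
  apply: stabD; first exact: fractional_span1.
  by exists 1; [exact: one_in_span1 | exact: oner_neq0].
have [a [b [abt Ea Eat Eb Ebt]]] := flat_span1_invertible fracD flatL.
have sET : {subset multiplier_ring (span1 t) <= T}.
  move=> y /mult_span1_sub/asboolP[u [v [Du Dv ->]]].
  exact: rpredD (sDT _ Du) (rpredM (sDT _ Dv) Tt).
exists a, b; split=> //; [exact: sET | exact: sET | |].
  exact: mult_span1_integral Eat.
exact: mult_span1_integral Ebt.
Qed.

End QuasiStable.

(** * Contraction of an ideal of an overring *)

Section Contraction.
Variables (K : fieldType) (D : subringClosed K) (I : zmodClosed K) (d : K).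
Implicit Types x y : K.

Lemma integral_closureB :
  {in integral_closure D &, forall x y, x - y \in integral_closure D}.
Proof.
by move=> x y /asboolP Ix /asboolP Iy; apply/asboolP; exact: integral_sub.
Qed.

Lemma integral_closureM :
  {in integral_closure D &, forall x y, x * y \in integral_closure D}.
Proof.
by move=> x y /asboolP Ix /asboolP Iy; apply/asboolP; exact: integral_mul.
Qed.

Lemma sub_integral_closure : {subset D <= integral_closure D}.
Proof.
move=> x Dx; apply/asboolP.
exact: (integral_id (val : {rmorphism subring_type D -> K}) (exist _ x Dx)).
Qed.

(** For nonzero d, the intersection of I with d^-1 times the integral closure
    of D. *)
Definition contraction : {pred K} :=
  [pred x | (x \in I) && (d * x \in integral_closure D)].

Fact contraction_zmod_closed : zmod_closed contraction.
Proof.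
split=> [|x y /andP[Ix Dx] /andP[Iy Dy]]; apply/andP; split.
- exact: rpred0.
- by rewrite mulr0; apply: sub_integral_closure; exact: rpred0.
- exact: rpredB.
- by rewrite mulrBr; exact: integral_closureB.
Qed.

HB.instance Definition _ :=
  GRing.isZmodClosed.Build K contraction contraction_zmod_closed.

End Contraction.

Theorem corollary3p8 (K : fieldType) (D : subringClosed K)
    (hK : is_quotient_field D)
    (hcond : ~ (colon D (integral_closure D) =i pred1 0))
    (hD : quasi_stable D) :
  forall T : subringClosed K, {subset D <= T} -> quasi_stable T.
Proof.
move=> T sDT I [TI [d [Td d_neq0 dI]]] [x0 Ix0 x0_neq0].
have [c c_neq0 cD] : exists2 c, c != 0 &
    forall y, y \in integral_closure D -> c * y \in D.
  apply: contrapT => noc; apply: hcond => y; rewrite [RHS]inE.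
  have [->|y_neq0] := eqVneq y 0.
    by apply/asboolP => z _; rewrite mul0r rpred0.
  by apply/asboolP => yD; apply: noc; exists y.
pose J := contraction D I d.
have sTI : {subset T <= multiplier_ring I}.
  by apply: mult_fractional; split=> //; exists d.
have JD a y : a \in D -> y \in J -> a * y \in J.
  move=> Da /andP[Iy Dy]; apply/andP.
  split; first exact: (TI _ _ (sDT _ Da) Iy).
  rewrite mulrCA; apply: integral_closureM => //.
  exact: sub_integral_closure.
(* A common denominator for J is c p, where d = p / q: the conductor element c
   takes d J into D, and c p = q (c d). *)
have fracJ : fractional_ideal D J.
  split=> //; have [p [q [Dp Dq q_neq0 dE]]] := hK d.
  have cp : c * p = q * (c * d) by rewrite dE mulrCA [q * _]mulrC divfK.
  exists (c * p); split.
  - by apply: cD; exact: sub_integral_closure.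
  - by rewrite cp !mulf_neq0.
  - move=> y /andP[_ Dy]; rewrite cp -!mulrA rpredM // cD //.
have JT x : x \in I ->
    exists y z t, [/\ y \in J, z \in J, t \in T & x = y + z * t].
  move=> Ix; set t := d * x; have Tt : t \in T by exact: dI.
  have [a [b [abt Ta Tb Dat Dbt]]] := overring_unit_decomposition hK hD sDT Tt.
  exists (a * x), (b * x), t.
  split=> //; last by rewrite mulrAC -mulrDl abt mul1r.
  - by apply/andP; split; [exact: TI | rewrite mulrCA].
  - by apply/andP; split; [exact: TI | rewrite mulrCA].
have J_neq0 : exists2 y, y \in J & y != 0.
  have [y [z [t [Jy Jz _ x0E]]]] := JT _ Ix0.
  have [y0|] := eqVneq y 0; last by exists y.
  exists z => //; apply: contra_neq x0_neq0 => z0.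
  by rewrite x0E y0 z0 mul0r addr0.
have sDJ := mult_fractional fracJ.
have sJI : {subset J <= I} by move=> y /andP[].
apply: (@quasi_stable_ideal_extension K J I).
- by move=> x; have [a [b [Da Db b0 ->]]] := hK x; exists a, b; rewrite !sDJ.
- exact: sJI.
- move=> e /asboolP eJ; apply/asboolP => x /JT[y [z [t [Jy Jz Tt ->]]]].
  rewrite mulrDr mulrA rpredD ?(sJI _ (eJ _ Jy)) //.
  by rewrite mulrC TI ?sJI ?eJ.
- exact: J_neq0.
- move=> x /JT[y [z [t [Jy Jz Tt ->]]]]; apply: add_spanD; apply: AddSpanGen.
    by exists y, 1; rewrite mulr1 rpred1.
  by exists z, t; rewrite sTI.
- exact: hD.
Qed.
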